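(* Let $k$ be a field, $G$ an abelian group, $\epsilon$ a skew-symmetric bicharacter of $G$ over $k$, $A$ a finite-dimensional left-symmetric color algebra with respect to $(G,\epsilon)$, and $V$ a finite-dimensional $A$-bimodule. Let $\mathrm{Hom}(A,V)$ be the $G$-graded vector space of all $k$-linear maps from $A$ to $V$. Then the left action $$(xf)(z):=xf(z)-\epsilon(|x|,|f|)f(xz)+\epsilon(|x|,|f|)f(x)z$$ for all homogeneous $x,z\in A$ and $f\in\mathrm{Hom}(A,V)$, together with the trivial right action ($fx=0$ for all $f\in\mathrm{Hom}(A,V)$, $x\in A$), defines a right-trivial $A$-bimodule structure on $\mathrm{Hom}(A,V)$.
   Context: Conventions. $k$ is a field of any characteristic; all algebras and modules are finite-dimensional. A skew-symmetric bicharacter of an abelian group $G$ over $k$ is a map $\epsilon:G\times G\to k^\times$ with $\epsilon(a,b+c)=\epsilon(a,b)\epsilon(a,c)$, $\epsilon(a+b,c)=\epsilon(a,c)\epsilon(b,c)$ and $\epsilon(a,b)\epsilon(b,a)=1$. $|x|\in G$ denotes the degree of a homogeneous element or map $x$. Formulas given on homogeneous elements are extended linearly. Left-symmetric color algebra: a (nonassociative) $G$-graded $k$-algebra $A=\bigoplus_{a\in G}A_a$, $A_aA_b\subseteq A_{a+b}$, with $(xy)z-x(yz)=\epsilon(|x|,|y|)\big((yx)z-y(xz)\big)$ for homogeneous $x,y,z$. $A$-bimodule: a $G$-graded vector space $W$ with bilinear degree-compatible left and right actions of $A$ (i.e. $A_aW_b\subseteq W_{a+b}$, $W_bA_a\subseteq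 W_{a+b}$) such that for homogeneous $x,y\in A$, $w\in W$: $(xy)w-x(yw)=\epsilon(|x|,|y|)\big((yx)w-y(xw)\big)$ and $(xw)y-x(wy)=\epsilon(|x|,|w|)\big((wx)y-w(xy)\big)$. A bimodule $W$ is right-trivial if $wx=0$ for all $x\in A$, $w\in W$. Grading: $\mathrm{Hom}(A,V)=\bigoplus_{c\in G}\mathrm{Hom}_c(A,V)$, where $\mathrm{Hom}_c(A,V)$ is the space of linear maps $f$ with $f(A_a)\subseteq V_{a+c}$ for all $a\in G$ (homogeneous of degree $c$). *)

(* Defs.v *)
From HB Require Import structures.
From mathcomp Require Import all_boot all_algebra.
From mathcomp Require Import finmap.
From mathcomp Require Import boolp classical_sets.

Set Implicit Arguments.
Unset Strict Implicit.
Unset Printing Implicit Defensive.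

Import GRing.Theory.

Local Open Scope ring_scope.
Local Open Scope classical_set_scope.

Record skew_bicharacter (k : fieldType) (G : zmodType) (eps : G -> G -> k)
    : Prop := SkewBicharacter {
  bichar_neq0 : forall a b, eps a b != 0;
  bicharDr : forall a b c, eps a (b + c) = eps a b * eps a c;
  bicharDl : forall a b c, eps (a + b) c = eps a c * eps b c;
  bichar_skew : forall a b, eps a b * eps b a = 1
}.

(* W is the internal direct sum of the subspaces Wg a: every w is, in exactly *)
(* one way, a sum of a finitely supported family of elements of the Wg a.     *)
Record is_grading (k : fieldType) (G : zmodType) (W : vectType k)
    (Wg : G -> set W) : Prop := IsGrading {
  grading_submod : forall a, submod_closed [in Wg a];
  grading_direct : forall w : W, exists! u : {fsfun G -> W with 0},
    (forall a, Wg a (u a)) /\ \sum_(a <- finsupp u) u a = w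
}.

(* Products and actions are bilinear by typing: the product of A is           *)
(* mul : 'Hom(A, 'End(A)), with x y written mul x y. A homogeneous element of *)
(* degree a is an element of Ag a; 0 has every degree, which is harmless      *)
(* since the identities below are trivial when an argument is 0.              *)
Record left_symmetric_color_algebra (k : fieldType) (G : zmodType)
    (eps : G -> G -> k) (A : vectType k) (Ag : G -> set A)
    (mul : 'Hom(A, 'End(A))) : Prop := LeftSymmetricColorAlgebra {
  lsca_grading : is_grading Ag;
  lsca_mul_graded : forall a b x y, Ag a x -> Ag b y -> Ag (a + b) (mul x y);
  lsca_left_symmetric : forall a b c x y z, Ag a x -> Ag b y -> Ag c z ->
    mul (mul x y) z - mul x (mul y z) =
    eps a b *: (mul (mul y x) z - mul y (mul x z))
}.

(* l x w is the left action x w and r w x is the right action w x.            *)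
Record color_bimodule (k : fieldType) (G : zmodType) (eps : G -> G -> k)
    (A : vectType k) (Ag : G -> set A) (mul : 'Hom(A, 'End(A)))
    (W : vectType k) (Wg : G -> set W)
    (l : 'Hom(A, 'End(W))) (r : 'Hom(W, 'Hom(A, W)))
    : Prop := ColorBimodule {
  bimod_grading : is_grading Wg;
  bimod_left_graded : forall a b x w, Ag a x -> Wg b w -> Wg (a + b) (l x w);
  bimod_right_graded : forall a b w x, Wg b w -> Ag a x -> Wg (b + a) (r w x);
  bimod_left : forall a b c x y w, Ag a x -> Ag b y -> Wg c w ->
    l (mul x y) w - l x (l y w) = eps a b *: (l (mul y x) w - l y (l x w));
  bimod_middle : forall a b c x y w, Ag a x -> Ag b y -> Wg c w ->
    r (l x w) y - l x (r w y) = eps a c *: (r (r w x) y - r w (mul x y))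
}.

Definition right_trivial_bimodule (k : fieldType) (G : zmodType)
    (eps : G -> G -> k) (A : vectType k) (Ag : G -> set A)
    (mul : 'Hom(A, 'End(A))) (W : vectType k) (Wg : G -> set W)
    (l : 'Hom(A, 'End(W))) (r : 'Hom(W, 'Hom(A, W))) : Prop :=
  color_bimodule eps Ag mul Wg l r /\ forall (w : W) (x : A), r w x = 0.

Definition hom_deg (k : fieldType) (G : zmodType) (A V : vectType k)
    (Ag : G -> set A) (Vg : G -> set V) (c : G) : set 'Hom(A, V) :=
  [set f | forall a x, Ag a x -> Vg (a + c) (f x)].

Definition is_hom_left_action (k : fieldType) (G : zmodType)
    (eps : G -> G -> k) (A : vectType k) (Ag : G -> set A)
    (mul : 'Hom(A, 'End(A))) (V : vectType k) (Vg : G -> set V)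
    (l : 'Hom(A, 'End(V))) (r : 'Hom(V, 'Hom(A, V)))
    (lH : 'Hom(A, 'End('Hom(A, V)))) : Prop :=
  forall a b c x z (f : 'Hom(A, V)),
    Ag a x -> Ag b z -> hom_deg Ag Vg c f ->
    lH x f z = l x (f z) - eps a c *: f (mul x z) + eps a c *: r (f x) z.

(* Main.v *)
(* The two gradings provide projections, hence a decomposition of every map   *)
(* f : A -> V into homogeneous ones and a left action of A on Hom(A, V)       *)
(* determined by the displayed formula. Compatibility with left symmetry is   *)
(* then checked on homogeneous x, y, f, z: the terms x(f(y)z) and y(f(x)z)    *)
(* are traded for the others by the middle identity of V, x(y f(z)) by the    *)
(* left identity of V, and f((xy)z) by left symmetry of A.                    *)
Require Import Defs.
From HB Require Import structures.
From mathcomp Require Import all_boot all_algebra.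
From mathcomp Require Import finmap.
From mathcomp Require Import boolp classical_sets.
From mathcomp Require Import ring.

Set Implicit Arguments.
Unset Strict Implicit.
Unset Printing Implicit Defensive.

Import GRing.Theory.

Local Open Scope ring_scope.

(** For fixed degrees the formula for xf is bilinear in x and f; the degrees enter only through the
    factor [eps a c]. It therefore determines exactly one bilinear action once A and Hom(A, V) are
    direct sums of their homogeneous parts. For Hom(A, V) this rests on finite dimension: only
    finitely many degrees occur in A and V, so f is a finite sum of blocks from A_a to V_b, each of
    degree b - a ([hom_grading]). The blockwise formulas then glue ([hom_left_action_exists]). With
    zero right action the middle identity reads 0 = 0, so what remains is that (xy)f - x(yf) is
    [eps]-symmetric in x and y, checked on homogeneous elements ([hom_left_action_left]). *)

Lemma fun_of_lfun_lin (k : fieldType) (U W : vectType k) (f : 'Hom(U, W)) :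
  (forall u v, f (u + v) = f u + f v) * (forall u, f (- u) = - f u) *
  (forall a u, f (a *: u) = a *: f u).
Proof.
by split; [split=> [u v|u]|move=> a u]; rewrite ?linearD ?linearN ?linearZ.
Qed.

Lemma linear_lfun (k : fieldType) (U W : vectType k) (f : U -> W) :
  linear f -> exists g : 'Hom(U, W), g =1 f.
Proof.
move=> lin_f.
pose fL : {linear U -> W} := HB.pack f (GRing.isLinear.Build k U W *:%R f lin_f).
by exists (linfun fL) => x; rewrite lfunE.
Qed.

Lemma bilinear_lfun (k : fieldType) (T U W : vectType k) (B : T -> U -> W) :
  (forall x, linear (B x)) -> (forall u, linear (B^~ u)) ->
  exists g : 'Hom(T, 'Hom(U, W)), forall x u, g x u = B x u.
Proof.
move=> linr linl.
have [h hE] := choice (fun x => linear_lfun (linr x)).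
have lin_h : linear h.
  by move=> a x y; apply/lfunP => u; rewrite !lfun_simp !hE linl.
by have [g gE] := linear_lfun lin_h; exists g => x u; rewrite gE hE.
Qed.

(** Coordinates separate vectors. This turns vector identities into scalar ones, which [ring] and
    [field] can settle. *)
Lemma eq_from_functionals (k : fieldType) (W : vectType k) (u v : W) :
  (forall phi : {scalar W}, phi u = phi v) -> u = v.
Proof.
move=> eq_phi; rewrite (coord_vbasis (memvf u)) (coord_vbasis (memvf v)).
apply: eq_bigr => i _; congr (_ *: _).
exact: (eq_phi (coord (vbasis fullv) i)).
Qed.

(** * Gradings and their projections *)

Lemma sum_finsupp_incl (k : fieldType) (G : choiceType) (W : vectType k)
    (u : {fsfun G -> W with 0}) (s : {fset G}) :
  (forall a, a \notin s -> u a = 0) ->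
  \sum_(a <- finsupp u) u a = \sum_(a <- s) u a.
Proof.
move=> u0; apply: big_fset_incl => [|a _ /fsfun_dflt //].
apply/fsubsetP => a; rewrite mem_finsupp; apply: contraR => /u0 ->.
by rewrite eqxx.
Qed.

Lemma sum_delta (G : choiceType) (W : zmodType) (s : {fset G}) (b : G) (w : W) :
  \sum_(a <- s) (if a == b then w else 0) = if b \in s then w else 0.
Proof.
case: ifP => bs.
  rewrite (big_fsetD1 b) //= eqxx big_seq big1 ?addr0 // => a.
  by rewrite !inE => /andP[/negPf->].
rewrite big_seq big1 // => a as_; case: eqP => // ab.
by rewrite -ab as_ in bs.
Qed.

(** A working form of [is_grading]: linear projections with one finite index set, which can be
    composed with linear maps and summed. *)
Record graded_projections (k : fieldType) (G : zmodType) (W : vectType k)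
    (Wg : G -> set W) (s : {fset G}) (p : G -> 'End(W)) : Prop :=
  GradedProjections {
    gproj_mem : forall a w, Wg a (p a w);
    gproj_sum : forall w, \sum_(a <- s) p a w = w;
    gproj_homog : forall a b w, Wg b w -> p a w = if a == b then w else 0
  }.

Section GradedProjections.

Variables (k : fieldType) (G : zmodType) (W : vectType k) (Wg : G -> set W).

Lemma grading_lin (a : G) (c : k) (u v : W) :
  is_grading Wg -> Wg a u -> Wg a v -> Wg a (c *: u + v).
Proof.
case=> /(_ a)[_ clos] _ Wu Wv; apply: set_mem; apply: clos; exact: mem_set.
Qed.

Lemma grading0 (a : G) : is_grading Wg -> Wg a 0.
Proof. by case=> /(_ a)[h _] _; apply: set_mem. Qed.

Lemma gradingD (a : G) (u v : W) :
  is_grading Wg -> Wg a u -> Wg a v -> Wg a (u + v).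
Proof. by move=> gW Wu Wv; rewrite -[u]scale1r; apply: grading_lin. Qed.

Lemma gradingZ (a : G) (c : k) (u : W) : is_grading Wg -> Wg a u -> Wg a (c *: u).
Proof.
by move=> gW Wu; rewrite -[_ *: _]addr0; apply: grading_lin => //; apply: grading0.
Qed.

Lemma gproj_notin (s : {fset G}) (p : G -> 'End(W)) (a : G) (w : W) :
  graded_projections Wg s p -> a \notin s -> p a w = 0.
Proof.
move=> gp as_; rewrite -[w](gproj_sum gp) linear_sum /= big_seq big1 // => b bs.
rewrite (gproj_homog gp _ (gproj_mem gp b w)).
by case: eqP as_ => // ->; rewrite bs.
Qed.

Lemma gproj_sum_incl (s t : {fset G}) (p : G -> 'End(W)) (w : W) :
  graded_projections Wg s p -> (s `<=` t)%fset -> \sum_(a <- t) p a w = w.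
Proof.
move=> gp st; rewrite -[RHS](gproj_sum gp).
by symmetry; apply: big_fset_incl => // a _ /gproj_notin; apply.
Qed.

Lemma graded_projections_grading (s : {fset G}) (p : G -> 'End(W)) :
  (forall a, submod_closed [in Wg a]) -> graded_projections Wg s p ->
  is_grading Wg.
Proof.
move=> sub gp; split=> // w.
pose u : {fsfun G -> W with 0} := [fsfun a in s => p a w | 0].
have uE a : u a = p a w.
  by rewrite fsfunE; case: ifPn => // /(gproj_notin w gp) ->.
exists u; split.
  split=> [a|]; first by rewrite uE; apply: gproj_mem gp _ _.
  rewrite (sum_finsupp_incl (s := s)) => [|a /(gproj_notin w gp)]; last by rewrite uE.
  by under eq_bigr do rewrite uE; apply: gproj_sum gp _.
(* Uniqueness: [p a] applied to the sum of any homogeneous decomposition returns its component of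
   degree [a]. *)
move=> v [vW vsum]; apply/fsfunP => a; rewrite uE -vsum linear_sum /=.
under eq_bigr do rewrite (gproj_homog gp a (vW _)) eq_sym.
have -> : \sum_(i <- finsupp v) (if i == a then v i else 0)
   = \sum_(i <- finsupp v) (if i == a then v a else 0).
  by apply: eq_bigr => i _; case: eqP => // ->.
by rewrite sum_delta; case: ifPn => // /fsfun_dflt ->.
Qed.

(* The projections vanish outside the finitely many degrees occurring in a    *)
(* basis of W; this is what makes the finite index set s uniform in w.        *)
Lemma grading_graded_projections :
  is_grading Wg -> exists s p, graded_projections Wg s p.
Proof.
move=> gW; have [u /all_and2[/all_and2[uW usum] uuniq]] := choice (grading_direct gW).
have uP w (v : {fsfun G -> W with 0}) (s : {fset G}) :
    (forall a, a \notin s -> v a = 0) -> (forall a, Wg a (v a)) ->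
    \sum_(a <- s) v a = w -> u w = v.
  by move=> v0 vW vsum; apply: uuniq; split=> //; rewrite (sum_finsupp_incl v0).
(* By uniqueness of decompositions: combining those of [w] and [w'] linearly decomposes the combined
   vector. *)
have lin_u a : linear (fun w => u w a).
  move=> c w w'; pose s := (finsupp (u w) `|` finsupp (u w'))%fset.
  have s0 (b : G) : b \notin s -> u w b = 0 /\ u w' b = 0.
    by rewrite inE negb_or => /andP[/fsfun_dflt-> /fsfun_dflt->].
  pose v : {fsfun G -> W with 0} := [fsfun b in s => c *: u w b + u w' b | 0].
  have vE b : v b = c *: u w b + u w' b.
    by rewrite fsfunE; case: ifPn => // /s0[-> ->]; rewrite scaler0 addr0.
  rewrite (uP _ v s) ?vE // => [b /s0[u0 u0']|b|].
  - by rewrite vE u0 u0' scaler0 addr0.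
  - by rewrite vE; apply: grading_lin.
  under eq_bigr do rewrite vE.
  rewrite big_split -scaler_sumr /= -!(@sum_finsupp_incl k) ?usum // => b;
    by case/s0.
have [p pE] := choice (fun a => linear_lfun (lin_u a)).
pose e := vbasis (fullv : {vspace W}).
pose s := (\bigcup_(w <- (e : seq W)) finsupp (u w))%fset.
have p0 a w : a \notin s -> p a w = 0.
  move=> as_; rewrite (coord_vbasis (memvf w)) linear_sum big1 // => i _.
  rewrite linearZ /= pE fsfun_dflt ?scaler0 //.
  apply: contra as_ => ai; apply/bigfcupP.
  by exists (e`_i) => //; rewrite mem_nth // size_tuple.
exists s, p; split=> [a w|w|a b w Ww].
- by rewrite pE.
- under eq_bigr do rewrite pE.
  rewrite -(@sum_finsupp_incl k) ?usum // => a /(p0 a w).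
  by rewrite pE.
pose v : {fsfun G -> W with 0} := [fsfun c in [fset b]%fset => w | 0].
have vE c : v c = if c == b then w else 0 by rewrite fsfunE inE.
rewrite pE (uP w v [fset b]%fset) ?vE // => [c|c|].
- by rewrite inE vE => /negPf->.
- by rewrite vE; case: eqP => [->|_] //; apply: grading0.
- by rewrite big_seq_fset1 vE eqxx.
Qed.

Lemma eq_on_homogeneous (U : vectType k) (f g : 'Hom(W, U)) :
  is_grading Wg -> (forall a w, Wg a w -> f w = g w) -> f = g.
Proof.
case/grading_graded_projections=> s [p gp] fg; apply/lfunP => w.
rewrite -[w](gproj_sum gp) !linear_sum; apply: eq_bigr => a _.
by apply: fg; apply: gproj_mem gp _ _.
Qed.

End GradedProjections.

(* The degree c component of f is the sum over a of pV (a + c) \o f \o pA a.  *)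
Lemma hom_grading (k : fieldType) (G : zmodType) (A V : vectType k)
    (Ag : G -> set A) (Vg : G -> set V) :
  is_grading Ag -> is_grading Vg -> is_grading (hom_deg Ag Vg).
Proof.
move=> gA gV.
have [sA [pA gpA]] := grading_graded_projections gA.
have [sV [pV gpV]] := grading_graded_projections gV.
have lin_P c : linear (fun f : 'Hom(A, V) => \sum_(a <- sA) (pV (a + c) \o f \o pA a)%VF).
  move=> t f g; rewrite scaler_sumr -big_split /=; apply: eq_bigr => a _.
  by rewrite comp_lfunDr comp_lfunDl -comp_lfunZr -comp_lfunZl.
have [P PE] := choice (fun c => linear_lfun (lin_P c)).
have {}PE c f x : P c f x = \sum_(a <- sA) pV (a + c) (f (pA a x)).
  by rewrite PE sum_lfunE; apply: eq_bigr => a _; rewrite !comp_lfunE.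
(* A block from degree [a] to degree [b] has degree [b - a]. *)
pose S := [fset (b - a)%R | a in sA, b in sV]%fset.
apply: (@graded_projections_grading _ _ _ _ S P).
  move=> c; split; first by apply: mem_set => a x _; rewrite lfunE /=; apply: grading0.
  move=> t f g /set_mem hf /set_mem hg; apply: mem_set => a x Ax.
  by rewrite !lfun_simp; apply: grading_lin => //; [apply: hf|apply: hg].
split=> [c f a x Ax|f|c d f hf].
- rewrite PE; under eq_bigr do rewrite (gproj_homog gpA _ Ax) (fun_if f) (fun_if (pV _)) !linear0.
  have -> : \sum_(i <- sA) (if i == a then pV (i + c) (f x) else 0)
     = \sum_(i <- sA) (if i == a then pV (a + c) (f x) else 0).
    by apply: eq_bigr => i _; case: eqP => // ->.
  rewrite sum_delta; case: ifP => _; last exact: grading0.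
  exact: gproj_mem gpV _ _.
- apply/lfunP => x; rewrite sum_lfunE; under eq_bigr do rewrite PE.
  rewrite exchange_big /= -[in RHS](gproj_sum gpA x) linear_sum big_seq [RHS]big_seq.
  apply: eq_bigr => a asA.
  (* The translate of [S] by [a] contains [sV], because b = a + (b - a); projections to degrees
     outside [sV] vanish. *)
  transitivity (\sum_(b <- [fset (a + c)%R | c in S]%fset) pV b (f (pA a x))).
    by rewrite big_imfset //= => b b' _ _ /addrI.
  apply: (gproj_sum_incl _ gpV); apply/fsubsetP => b bsV.
  apply/imfsetP; exists (b - a); last by rewrite addrC subrK.
  by apply/imfset2P; exists a => //; exists b.
apply/lfunP => x; rewrite PE.
under eq_bigr do
  rewrite (gproj_homog gpV _ (hf _ _ (gproj_mem gpA _ x))) (inj_eq (addrI _)).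
by case: eqP => _; [rewrite -linear_sum (gproj_sum gpA)|rewrite big1 ?lfunE].
Qed.

(** * The left action on Hom(A, V) *)

Section HomAction.

Variables (k : fieldType) (G : zmodType) (eps : G -> G -> k).
Variables (A : vectType k) (Ag : G -> set A) (mul : 'Hom(A, 'End(A))).
Variables (V : vectType k) (Vg : G -> set V).
Variables (l : 'Hom(A, 'End(V))) (r : 'Hom(V, 'Hom(A, V))).

Lemma hom_left_action_exists : is_grading Ag -> is_grading Vg ->
  exists lH, is_hom_left_action eps Ag mul Vg l r lH.
Proof.
move=> gA gV.
have [sA [pA gpA]] := grading_graded_projections gA.
have [sH [pH gpH]] := grading_graded_projections (hom_grading gA gV).
pose B a c x (f : 'Hom(A, V)) : 'Hom(A, V) :=
  (l x \o f)%VF - eps a c *: (f \o mul x)%VF + eps a c *: r (f x).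
have BE a c x f z :
    B a c x f z = l x (f z) - eps a c *: f (mul x z) + eps a c *: r (f x) z.
  by rewrite !lfun_simp.
clearbody B.
have linBr a c x : linear (B a c x).
  move=> t f g; apply/lfunP => z; rewrite add_lfunE scale_lfunE !BE.
  apply: eq_from_functionals => phi.
  rewrite !(add_lfunE, opp_lfunE, scale_lfunE, fun_of_lfun_lin).
  rewrite !(linearD phi, linearN phi, scalarZ phi) /=; ring.
have linBl a c f : linear (B a c ^~ f).
  move=> t x y; apply/lfunP => z; rewrite add_lfunE scale_lfunE !BE.
  apply: eq_from_functionals => phi.
  rewrite !(add_lfunE, opp_lfunE, scale_lfunE, fun_of_lfun_lin).
  rewrite !(linearD phi, linearN phi, scalarZ phi) /=; ring.
have [b bE] := choice (fun ac => bilinear_lfun (linBr ac.1 ac.2) (linBl ac.1 ac.2)).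
(* Gluing: the bilinear map for degrees [a], [c] is applied to the components of [x] and [f] in
   those degrees. *)
have [g gE] : exists g : 'Hom(A, 'End('Hom(A, V))), forall x f,
    g x f = \sum_(a <- sA) \sum_(c <- sH) b (a, c) (pA a x) (pH c f).
  apply: bilinear_lfun => [x|f] t f1 f2; rewrite scaler_sumr -big_split;
    apply: eq_bigr => a _ /=; rewrite scaler_sumr -big_split; apply: eq_bigr => c _ /=.
  - by rewrite !linearP.
  - by rewrite !linearP add_lfunE scale_lfunE.
exists g => a d c x z f Ax Az hf; rewrite gE -BE -[B a c x f](bE (a, c)).
congr (fun_of_lfun _ z); rewrite -[in RHS](gproj_sum gpA x) linear_sum sum_lfunE.
apply: eq_bigr => a' _ /=; rewrite -[in RHS](gproj_sum gpH f) linear_sum.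
apply: eq_bigr => c' _ /=.
rewrite (gproj_homog gpA _ Ax) (gproj_homog gpH _ hf).
case: eqP => [->|_]; last by rewrite !linear0 !lfunE.
by case: eqP => [->|_] //; rewrite !linear0.
Qed.

Hypothesis heps : skew_bicharacter eps.
Hypothesis hA : left_symmetric_color_algebra eps Ag mul.
Hypothesis hV : color_bimodule eps Ag mul Vg l r.

Variable lH : 'Hom(A, 'End('Hom(A, V))).
Hypothesis hH : is_hom_left_action eps Ag mul Vg l r lH.

Lemma hom_left_action_graded a c x f :
  Ag a x -> hom_deg Ag Vg c f -> hom_deg Ag Vg (a + c) (lH x f).
Proof.
move=> Ax hf d z Az; rewrite (hH Ax Az hf).
have gV := bimod_grading hV.
apply: gradingD => //; first rewrite -scaleNr.
  apply: gradingD => //; last apply: gradingZ => //.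
    by rewrite addrCA; apply: bimod_left_graded hV _ _ _ _ Ax _; apply: hf.
  by rewrite addrA [d + a]addrC; apply: hf; apply: lsca_mul_graded hA _ _ _ _ Ax Az.
apply: gradingZ => //; rewrite [d + _]addrC.
by apply: bimod_right_graded hV _ _ _ _ _ Az; apply: hf.
Qed.

(** In (xy)f - x(yf) at z, the middle identity at f(y) replaces the terms x(f(y)z), (f(y)x)z and
    f(y)(xz) by a multiple of (xf(y))z, which pairs with (yf(x))z under the exchange of x and y. The
    terms xf(yz) and yf(xz), and likewise f(xy)z and f(yx)z, pair in the same way. The rest is the
    left identity of V at f(z) and f applied to left symmetry of A. *)
Lemma hom_left_action_left a b c x y f :
  Ag a x -> Ag b y -> hom_deg Ag Vg c f ->
  lH (mul x y) f - lH x (lH y f) = eps a b *: (lH (mul y x) f - lH y (lH x f)).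
Proof.
move=> Ax Ay hf; apply: (eq_on_homogeneous (lsca_grading hA)) => d z Az.
have Axy := lsca_mul_graded hA Ax Ay; have Ayx := lsca_mul_graded hA Ay Ax.
have Axz := lsca_mul_graded hA Ax Az; have Ayz := lsca_mul_graded hA Ay Az.
have hyf := hom_left_action_graded Ay hf; have hxf := hom_left_action_graded Ax hf.
rewrite !lfun_simp.
rewrite (hH Axy Az hf) (hH Ayx Az hf) (hH Ax Az hyf) (hH Ay Az hxf).
rewrite (hH Ay Az hf) (hH Ax Az hf) (hH Ay Axz hf) (hH Ax Ayz hf).
rewrite (hH Ay Ax hf) (hH Ax Ay hf).
(* Once evaluated, the goal is a linear combination of these four identities: *)
(* the left identity of V at f z, f applied to left symmetry of A, and the    *)
(* middle identity of V at f y and at f x.                                    *)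
have E1 := bimod_left hV Ax Ay (hf _ _ Az).
have E2 := lsca_left_symmetric hA Ax Ay Az.
have E3 := bimod_middle hV Ax Az (hf _ _ Ay).
have E4 := bimod_middle hV Ay Az (hf _ _ Ax).
apply: eq_from_functionals => phi.
move/(congr1 phi): E1; move/(congr1 f)/(congr1 phi): E2.
move/(congr1 phi): E3; move/(congr1 phi): E4.
rewrite !(bicharDr heps) !(bicharDl heps).
(* Leaves [eps a b] as the only denominator, so that [field] needs just its nonvanishing. *)
have -> : eps b a = (eps a b)^-1.
  by rewrite -[RHS]mul1r -(bichar_skew heps a b) mulrAC mulfV ?mul1r //
    (bichar_neq0 heps).
have := bichar_neq0 heps a b.
rewrite !(add_lfunE, opp_lfunE, scale_lfunE, fun_of_lfun_lin).
rewrite !(linearD phi, linearN phi, scalarZ phi) /=.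
(* Each identity is solved for its first term, which is then eliminated. *)
move=> ab0 /eqP; rewrite subr_eq => /eqP ->.
move=> /eqP; rewrite subr_eq => /eqP ->.
move=> /eqP; rewrite subr_eq => /eqP ->.
move=> /eqP; rewrite subr_eq => /eqP ->.
by field.
Qed.

End HomAction.

Theorem proposition2p16 (k : fieldType) (G : zmodType) (eps : G -> G -> k)
    (A : vectType k) (Ag : G -> set A) (mul : 'Hom(A, 'End(A)))
    (V : vectType k) (Vg : G -> set V)
    (l : 'Hom(A, 'End(V))) (r : 'Hom(V, 'Hom(A, V)))
    (heps : skew_bicharacter eps)
    (hA : left_symmetric_color_algebra eps Ag mul)
    (hV : color_bimodule eps Ag mul Vg l r) :
  (exists! lH : 'Hom(A, 'End('Hom(A, V))),
     is_hom_left_action eps Ag mul Vg l r lH) /\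
  (forall lH : 'Hom(A, 'End('Hom(A, V))),
     is_hom_left_action eps Ag mul Vg l r lH ->
     right_trivial_bimodule eps Ag mul (hom_deg Ag Vg) lH
       (0 : 'Hom('Hom(A, V), 'Hom(A, 'Hom(A, V))))).
Proof.
have gA := lsca_grading hA; have gV := bimod_grading hV.
have gH := hom_grading gA gV; split.
  have [lH hH] := hom_left_action_exists eps mul l r gA gV.
  exists lH; split=> // lH' hH'.
  (* Uniqueness: the formula fixes all values at homogeneous [x], [f], [z], and these span. *)
  apply: (eq_on_homogeneous gA) => a x Ax; apply: (eq_on_homogeneous gH) => c f hf.
  apply: (eq_on_homogeneous gA) => b z Az.
  by rewrite (hH _ _ _ _ _ _ Ax Az hf) (hH' _ _ _ _ _ _ Ax Az hf).
move=> lH hH; split; last by move=> f x; rewrite !zero_lfunE.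
split=> // [|a c f x _ _||a b c x y f _ _ _].
- exact: (hom_left_action_graded hA hV hH).
- by rewrite !zero_lfunE; apply: grading0.
- exact: (hom_left_action_left heps hA hV hH).
- by rewrite !zero_lfunE linear0 subrr scaler0.
Qed.
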